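(* For $n\ge4$, $$\widetilde D_n(t_0,\dots,t_n)=\frac12\sum_{u\in S_n}d_1(u)\cdots d_n(u),$$ where $$d_1(u):=t_1^{\chi(u_1>u_2)}+t_2^{\chi(u_1>u_2)},\qquad d_2(u):=(t_1t_2)^{\chi(u_1<u_2)}+t_3^{\chi(u_2>u_3)},$$ $$d_i(u):=t_i^{\chi(u_{i-1}<u_i)}+t_{i+1}^{\chi(u_i>u_{i+1})}\quad\text{for }2<i<n-1,$$ $$d_{n-1}(u):=t_{n-1}^{\chi(u_{n-2}<u_{n-1})}+(t_0t_n)^{\chi(u_{n-1}>u_n)},\qquad d_n(u):=t_n^{\chi(u_{n-1}<u_n)}+t_0^{\chi(u_{n-1}<u_n)}.$$
   Context: $S_n$ is the symmetric group on $\{1,\dots,n\}$, with permutations written $u=u_1\cdots u_n$. $\chi(S)=1$ if the statement $S$ is true and $0$ if it is false. The Weyl group $D_n$ is the group of signed permutations $w$ (permutations of $\{\pm1,\dots,\pm n\}$ with $w(-i)=-w(i)$, written $w=w_1\cdots w_n$ with $w_i=w(i)$) having an even number of negative entries among $w_1,\dots,w_n$. The simple roots are $\alpha_1=\varepsilon_2+\varepsilon_1$, $\alpha_i=\varepsilon_i-\varepsilon_{i-1}$ ($2\le i\le n$), and the lowest root is $\alpha_0=-\varepsilon_{n-1}-\varepsilon_n$. The affine descent set $\widetilde{\mathrm{Des}}(w)\subseteq\{0,1,\dots,n\}$ of $w\in D_n$ consists of all $i\in\{2,\dots,n\}$ with $w_{i-1}>w_i$, together with $1$ if $w_1+w_2<0$,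 and $0$ if $w_{n-1}+w_n>0$. The multivariate affine Eulerian polynomial is $\widetilde D_n(t_0,\dots,t_n)=\sum_{w\in D_n}\prod_{i\in\widetilde{\mathrm{Des}}(w)}t_i$. *)

(* Defs.v *)
From mathcomp Require Import all_boot all_order all_fingroup all_algebra.
From mathcomp Require Export mpoly.

Set Implicit Arguments.
Unset Strict Implicit.
Unset Printing Implicit Defensive.

Import GRing.Theory Num.Theory.
Local Open Scope ring_scope.

(* The set {±1, ..., ±n}: the pair (i, b) encodes (-1)^b (i + 1). *)
Definition letter (n : nat) := ('I_n * bool)%type.

Definition letter_val (n : nat) (x : letter n) : int :=
  (-1) ^+ x.2 * (x.1.+1)%:Z.

Definition letter_opp (n : nat) (x : letter n) : letter n := (x.1, ~~ x.2).

(* The one-line notations carry a dummy entry 0 in front, so that their i-th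
   entry is the value at i for 1 <= i <= n. For n >= 2 the dummy entry is never
   compared with or added to another one, and it does not count as negative. *)
Definition oneline (n : nat) (u : 'S_n) : seq nat :=
  0%N :: [seq (u i).+1 | i <- enum 'I_n].

Definition signed_oneline (n : nat) (w : {perm letter n}) : seq int :=
  0 :: [seq letter_val (w (i, false)) | i <- enum 'I_n].

Definition weylD (n : nat) : {set {perm letter n}} :=
  [set w : {perm letter n} |
     [forall x : letter n, w (letter_opp x) == letter_opp (w x)]
     && ~~ odd (count (fun z : int => z < 0) (signed_oneline w))].

Definition affine_Des (n : nat) (w : {perm letter n}) : {set 'I_n.+1} :=
  let v i := nth 0 (signed_oneline w) i in
  [set i : 'I_n.+1 | if val i == 0%N then v n.-1 + v n > 0
                     else if val i == 1%N then v 1%N + v 2%N < 0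
                     else v i.-1 > v i].

Definition affine_eulerianD (n : nat) : {mpoly rat[n.+1]} :=
  \sum_(w in weylD n) \prod_(i in affine_Des w) 'X_i.

(* The factor d_i(u) for 1 <= i <= n and n >= 4; the comparisons in exponents
   are booleans coerced to nat, i.e. the indicator chi. *)
Definition d_factor (n : nat) (u : 'S_n) (i : nat) : {mpoly rat[n.+1]} :=
  let t j : {mpoly rat[n.+1]} := 'X_(inord j) in
  let v j := nth 0%N (oneline u) j in
  if i == 1%N then
    t 1%N ^+ (v 1 > v 2)%N + t 2%N ^+ (v 1 > v 2)%N
  else if i == 2%N then
    (t 1%N * t 2%N) ^+ (v 1 < v 2)%N + t 3%N ^+ (v 2 > v 3)%N
  else if i == n.-1 then
    t n.-1 ^+ (v n.-2 < v n.-1)%N + (t 0%N * t n) ^+ (v n.-1 > v n)%N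
  else if i == n then
    t n ^+ (v n.-1 < v n)%N + t 0%N ^+ (v n.-1 < v n)%N
  else
    t i ^+ (v i.-1 < v i)%N + t i.+1 ^+ (v i > v i.+1)%N.

(* Main.v *)
Require Import Defs.
From mathcomp Require Import all_boot all_order all_fingroup all_algebra.
From mathcomp Require Import ring zify.

(* Write a signed permutation as a pair (u, s) of absolute values and signs.
   Whether two entries form a descent (or have a positive sum) is decided by
   their relative order in u and by the sign of the entry with the larger
   absolute value. Charging each affine descent to that entry turns the descent
   monomial of (u, s) into a product over the positions i, whose i-th factor is
   the first summand of d_i(u) if s is negative at i and the second one
   otherwise. Hence the sum over all signed permutations is the sum over u of
   the products of the d_i(u). Changing the sign of the entry of absolute value
   1 preserves the monomial and changes the parity of the number of negative
   entries, so D_n accounts for exactly half of this sum. *)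

Local Open Scope ring_scope.

Import GRing.Theory Num.Theory.

Set Implicit Arguments.
Unset Strict Implicit.
Unset Printing Implicit Defensive.

(** * Signs of letters, of their differences and of their sums *)

Lemma letter_val_lt0 (n : nat) (x : letter n) : (letter_val x < 0) = x.2.
Proof. by case: x => i [] /=; rewrite /letter_val /=; lia. Qed.

Lemma letter_val_gt (n : nat) (x y : letter n) : x.1 != y.1 ->
  (letter_val x > letter_val y) = if (x.1 < y.1)%N then y.2 else ~~ x.2.
Proof.
case: x y => i b [j c]; rewrite -val_eqE /letter_val /=.
by case: ltngtP => // ij _; case: b; case: c => /=; lia.
Qed.

Lemma letter_val_add_lt0 (n : nat) (x y : letter n) : x.1 != y.1 ->
  (letter_val x + letter_val y < 0) = if (x.1 < y.1)%N then y.2 else x.2.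
Proof.
case: x y => i b [j c]; rewrite -val_eqE /letter_val /=.
by case: ltngtP => // ij _; case: b; case: c => /=; lia.
Qed.

Lemma letter_val_add_gt0 (n : nat) (x y : letter n) : x.1 != y.1 ->
  (letter_val x + letter_val y > 0) = if (x.1 < y.1)%N then ~~ y.2 else ~~ x.2.
Proof.
case: x y => i b [j c]; rewrite -val_eqE /letter_val /=.
by case: ltngtP => // ij _; case: b; case: c => /=; lia.
Qed.

(** * Signed permutations as pairs of a permutation and a sign vector *)

Section SignedPerm.

Variable n : nat.
Implicit Types (u : 'S_n) (s : {ffun 'I_n -> bool}).

Lemma signed_perm_inj u s :
  injective (fun x : letter n => (u x.1, s x.1 (+) x.2) : letter n).
Proof. by move=> [i b] [j c] /= [/perm_inj <- /addbI <-]. Qed.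

(** Signs are indexed by position: [p.2 i] tells whether the value at [i] is negative, and the xor
    makes the map odd. *)
Definition signed_perm (p : 'S_n * {ffun 'I_n -> bool}) : {perm letter n} :=
  perm (@signed_perm_inj p.1 p.2).

Lemma signed_permE p i b : signed_perm p (i, b) = (p.1 i, p.2 i (+) b).
Proof. by rewrite permE. Qed.

Lemma signed_perm_injective : injective signed_perm.
Proof.
move=> [u s] [u' s'] eq_us.
have eqi i : (u i, s i) = (u' i, s' i).
  have /= := signed_permE (u, s) i false.
  by rewrite eq_us signed_permE /= !addbF => ->.
congr pair; first by apply/permP => i; case: (eqi i).
by apply/ffunP => i; case: (eqi i).
Qed.

Lemma signed_perm_opp p x :
  signed_perm p (letter_opp x) = letter_opp (signed_perm p x).
Proof. by case: x => i b; rewrite !signed_permE /letter_opp /= addbN. Qed.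

Lemma signed_perm_surj (w : {perm letter n}) :
  (forall x, w (letter_opp x) = letter_opp (w x)) ->
  exists p, w = signed_perm p.
Proof.
move=> wN.
have wE i b : w (i, b) = ((w (i, false)).1, (w (i, false)).2 (+) b).
  by case: b; rewrite ?(wN (i, false)) ?addbT ?addbF // -surjective_pairing.
have u_inj : injective (fun i => (w (i, false)).1).
  move=> i j eq_ij.
  (* Giving [i] the sign of its own image yields the positive letter of absolute value
     [(w (i, false)).1], so injectivity of [w] applies. *)
  have : w (i, (w (i, false)).2) = w (j, (w (j, false)).2).
    by rewrite !(wE _ (_.2)) eq_ij !addbb.
  by move/perm_inj => [].
exists (perm u_inj, [ffun i => (w (i, false)).2]).
by apply/permP => -[i b]; rewrite signed_permE /= permE ffunE wE.
Qed.

Definition nb_neg s := count s (enum 'I_n).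

Lemma signed_oneline_neg p :
  count (fun z : int => z < 0) (signed_oneline (signed_perm p)) = nb_neg p.2.
Proof.
rewrite /= add0n count_map; apply: eq_count => i /=.
by rewrite letter_val_lt0 signed_permE /= addbF.
Qed.

Lemma weylD_signed_perm :
  weylD n = signed_perm @: [set p | ~~ odd (nb_neg p.2)].
Proof.
apply/setP => w; apply/idP/imsetP => [|[p]]; rewrite !inE.
  case/andP=> /forallP wN; have [x|p ->] := signed_perm_surj (w := w).
    exact/eqP.
  by rewrite signed_oneline_neg => p_even; exists p; rewrite ?inE.
move=> p_even ->; rewrite signed_oneline_neg p_even andbT.
by apply/forallP => x; rewrite signed_perm_opp.
Qed.

Lemma nth_signed_oneline p (i : 'I_n) :
  nth 0 (signed_oneline (signed_perm p)) i.+1 = letter_val (p.1 i, p.2 i).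
Proof.
by rewrite /= (nth_map i) ?size_enum_ord // nth_ord_enum signed_permE addbF.
Qed.

Lemma nth_oneline u (i : 'I_n) : nth 0%N (oneline u) i.+1 = (u i).+1.
Proof. by rewrite /= (nth_map i) ?size_enum_ord // nth_ord_enum. Qed.

(** * Sign flips and parity *)

Definition flip (i : 'I_n) s : {ffun 'I_n -> bool} :=
  [ffun j => s j (+) (j == i)].

Lemma flipK i : involutive (flip i).
Proof. by move=> s; apply/ffunP => j; rewrite !ffunE -addbA addbb addbF. Qed.

Lemma odd_nb_neg_flip i s : odd (nb_neg (flip i s)) = ~~ odd (nb_neg s).
Proof.
have E s' : nb_neg s' = (s' i + \sum_(j | j != i) s' j)%N.
  by rewrite /nb_neg -sum1_count big_enum_cond big_mkcond (bigD1 i).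
rewrite !E !ffunE eqxx addbT !oddD !oddb -addNb; congr (_ (+) odd _).
by apply: eq_bigr => j /negPf ji; rewrite ffunE ji addbF.
Qed.

(** Expanding the product gives a sum over all sign vectors. Flipping the sign at [i] exchanges the
    even and odd ones and keeps each summand, so both halves are equal. *)
Lemma sum_even_signs (R : comPzRingType) (T : 'I_n -> bool -> R) (i : 'I_n) :
  T i true = T i false ->
  \prod_j (T j true + T j false) =
    (\sum_(s : {ffun 'I_n -> bool} | ~~ odd (nb_neg s)) \prod_j T j (s j)) *+ 2.
Proof.
move=> Ti; under eq_bigr do rewrite -(big_bool +%R).
rewrite bigA_distr_bigA (bigID (fun s => ~~ odd (nb_neg s))) /= mulr2n.
congr (_ + _); rewrite (reindex_inj (inv_inj (flipK i))) /=.
apply: eq_big => [s|s _]; first by rewrite odd_nb_neg_flip negbK.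
apply: eq_bigr => j _; rewrite ffunE; case: eqP => [->|_]; last by rewrite addbF.
by case: (s i); rewrite Ti.
Qed.

(* The summand of d_i(u) selected by a negative (b = true) or positive sign. *)
Definition d_term u (i : nat) (b : bool) : {mpoly rat[n.+1]} :=
  let t j : {mpoly rat[n.+1]} := 'X_(inord j) in
  let v j := nth 0%N (oneline u) j in
  if i == 1%N then
    if b then t 1%N ^+ (v 1 > v 2)%N else t 2%N ^+ (v 1 > v 2)%N
  else if i == 2%N then
    if b then (t 1%N * t 2%N) ^+ (v 1 < v 2)%N else t 3%N ^+ (v 2 > v 3)%N
  else if i == n.-1 then
    if b then t n.-1 ^+ (v n.-2 < v n.-1)%N
    else (t 0%N * t n) ^+ (v n.-1 > v n)%N
  else if i == n then
    if b then t n ^+ (v n.-1 < v n)%N else t 0%N ^+ (v n.-1 < v n)%N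
  else
    if b then t i ^+ (v i.-1 < v i)%N else t i.+1 ^+ (v i > v i.+1)%N.

Lemma d_factorE u i : d_factor u i = d_term u i true + d_term u i false.
Proof. by rewrite /d_factor /d_term; do !case: ifP => //. Qed.

(** With boolean exponents over a range of naturals, the exceptional factors at the ends can be
    split off. *)
Lemma prod_affine_DesE (w : {perm letter n}) (des : nat -> bool) :
  (forall i : 'I_n.+1, (i \in affine_Des w) = des i) ->
  \prod_(i in affine_Des w) 'X_i =
    \prod_(0 <= j < n.+1) ('X_(inord j) : {mpoly rat[n.+1]}) ^+ des j.
Proof.
move=> desE; rewrite big_mkord big_mkcond; apply: eq_bigr => i _.
by rewrite inord_val desE; case: (des i).
Qed.

End SignedPerm.

(** * Descent monomials in rank at least 4 *)

Section LargeRank.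

Variable m : nat.
Local Notation n := m.+4.
Implicit Types (u : 'S_n) (s : {ffun 'I_n -> bool}).

Let v u j := nth 0%N (oneline u) j.
Let neg s j : bool := s (inord j.-1).

Lemma oneline_inord u j : (0 < j <= n)%N -> v u j = (u (inord j.-1)).+1.
Proof.
by case: j => // j /= jn; rewrite -(nth_oneline u) inordK.
Qed.

Lemma oneline_neq u j : (1 < j <= n)%N ->
  u (inord j.-2) != u (inord j.-1).
Proof.
move=> jn; rewrite (inj_eq perm_inj) -val_eqE /= !inordK; lia.
Qed.

(** In each branch the comparison in [u] selects the entry of larger absolute value, whose sign then
    decides. *)
Definition signed_des u s (j : nat) : bool :=
  if j == 0%N then if (v u n.-1 < v u n)%N then ~~ neg s n else ~~ neg s n.-1
  else if j == 1%N then if (v u 1 < v u 2)%N then neg s 2 else neg s 1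
  else if (v u j.-1 < v u j)%N then neg s j else ~~ neg s j.-1.

Lemma affine_Des_signed_perm u s (i : 'I_n.+1) :
  (i \in affine_Des (signed_perm (u, s))) = signed_des u s i.
Proof.
pose x j : letter n := (u (inord j.-1), neg s j).
have nthE j : (0 < j <= n)%N ->
    nth 0 (signed_oneline (signed_perm (u, s))) j = letter_val (x j).
  by case: j => // j jn; rewrite -(nth_signed_oneline (u, s)) inordK.
have xN j : (1 < j <= n)%N -> (x j.-1).1 != (x j).1 := @oneline_neq u j.
rewrite inE /signed_des; move: (nth _ _) nthE => f nthE.
case: i => -[|[|i]] /= ilt.
- rewrite !nthE ?leqnn ?leqnSn // [LHS](letter_val_add_gt0 (xN n (leqnn n))) /=.
  by rewrite !oneline_inord ?leqnn ?leqnSn.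
- rewrite !nthE ?leqnn ?leqnSn // [LHS](letter_val_add_lt0 (xN 2 isT)) /=.
  by rewrite !oneline_inord ?leqnn ?leqnSn.
- rewrite nthE // nthE; last exact: ltnW.
  rewrite [LHS](letter_val_gt (xN i.+2 ilt)) /=.
  by rewrite !oneline_inord //=; lia.
Qed.

Lemma oneline_gt u j : (1 < j <= n)%N ->
  (v u j < v u j.-1)%N = ~~ (v u j.-1 < v u j)%N.
Proof.
move=> jn; have := oneline_neq u jn; rewrite -val_eqE /=.
by rewrite (oneline_inord u (j := j)) ?(oneline_inord u (j := j.-1)); lia.
Qed.

(** Every exponent in the factor at a position tests whether the entry there exceeds a neighbour,
    which the smallest entry never does. *)
Lemma d_term_eq1 u (i : 'I_n) b : u i = ord0 -> d_term u i.+1 b = 1.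
Proof.
move=> ui0; have vi : nth 0%N (oneline u) i.+1 = 1%N by rewrite nth_oneline ui0.
(* The bounds on [j] exclude the dummy entry and the default value of [nth], both 0. *)
have vgt0 j : (0 < j <= n)%N -> nth 0%N (oneline u) j != 0%N.
  by move=> jn; rewrite [nth _ _ _]oneline_inord.
have nlt j : (0 < j <= n)%N -> (nth 0%N (oneline u) j < 1)%N = false.
  by move=> jn; move: (vgt0 _ jn); lia.
have ilt := ltn_ord i.
rewrite /d_term; case: eqP => [E|i1].
  by rewrite E in vi; rewrite vi nlt // if_same.
case: eqP => [E|i2]; first by rewrite E in vi; rewrite vi !nlt // if_same.
case: eqP => [E|i3]; first by rewrite E in vi; rewrite vi !nlt ?if_same //=; lia.
case: eqP => [E|i4]; first by rewrite E in vi; rewrite vi !nlt ?if_same //=; lia.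
by rewrite vi !nlt ?if_same //=; lia.
Qed.

Lemma prod_affine_Des_signed_perm u s :
  \prod_(i in affine_Des (signed_perm (u, s))) 'X_i =
    \prod_(i < n) d_term u i.+1 (s i).
Proof.
rewrite (prod_affine_DesE (affine_Des_signed_perm u s)).
pose t j : {mpoly rat[n.+1]} := 'X_(inord j).
(* The entry at [j] is charged [P j] for the descent with its left neighbour (larger and negative),
   and [Q j] for the one with its right neighbour (larger and positive). *)
pose P j := t j ^+ ((v u j.-1 < v u j)%N && neg s j).
pose Q j := t j.+1 ^+ (~~ (v u j < v u j.+1)%N && ~~ neg s j).
transitivity (\prod_(1 <= i < n.+1) d_term u i (neg s i)); last first.
  rewrite big_add1 big_mkord; apply: eq_bigr => i _.
  by rewrite /neg inord_val.
have desE j : (1 < j)%N -> t j ^+ signed_des u s j = P j * Q j.-1.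
  case: j => [|[|j]] // _; rewrite /signed_des /P /Q /=.
  by case: ltnP; rewrite /= ?mulr1 ?mul1r.
have termE j : (2 < j < m.+3)%N -> d_term u j (neg s j) = P j * Q j.
  move=> jn; rewrite /d_term /P /Q !ifN_eq; try lia.
  rewrite -/(v u _) -/(v u _) -/(v u _) (@oneline_gt u j.+1) /=; last lia.
  by case: (neg s j); rewrite ?andbT ?andbF ?mulr1 ?mul1r.
(* The two factors at each end also carry the powers of [t 1] and [t 0]: each of these two descents
   is charged to one of two adjacent entries, as [des0] and [des1] record. *)
have term1 : d_term u 1 (neg s 1) =
    Q 1 * t 1%N ^+ (~~ (v u 1 < v u 2)%N && neg s 1).
  rewrite /d_term /Q /= -/(v u _) -/(v u _) (@oneline_gt u 2) //=.
  by case: (neg s 1); rewrite ?andbT ?andbF ?mulr1 ?mul1r.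
have term2 : d_term u 2 (neg s 2) =
    P 2 * Q 2 * t 1%N ^+ ((v u 1 < v u 2)%N && neg s 2).
  rewrite /d_term /P /Q /= -/(v u _) -/(v u _) -/(v u _) (@oneline_gt u 3) //=.
  by case: (neg s 2); rewrite ?andbT ?andbF ?mulr1 ?mul1r ?exprMn // mulrC.
have term3 : d_term u m.+3 (neg s m.+3) =
    P m.+3 * Q m.+3 * t 0%N ^+ (~~ (v u m.+3 < v u m.+4)%N && ~~ neg s m.+3).
  rewrite /d_term /P /Q /= eqxx -/(v u _) -/(v u _) -/(v u _).
  rewrite (@oneline_gt u m.+4) //=.
  by case: (neg s m.+3); rewrite ?andbT ?andbF ?mulr1 ?mul1r ?exprMn // mulrC.
have term4 : d_term u m.+4 (neg s m.+4) =
    P m.+4 * t 0%N ^+ ((v u m.+3 < v u m.+4)%N && ~~ neg s m.+4).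
  rewrite /d_term /P /= eqxx gtn_eqF // -/(v u _) -/(v u _).
  by case: (neg s m.+4); rewrite ?andbT ?andbF ?mulr1 ?mul1r.
have des0 : t 0%N ^+ signed_des u s 0 =
    t 0%N ^+ (~~ (v u m.+3 < v u m.+4)%N && ~~ neg s m.+3)
    * t 0%N ^+ ((v u m.+3 < v u m.+4)%N && ~~ neg s m.+4).
  by rewrite /signed_des /=; case: ltnP; rewrite /= ?mulr1 ?mul1r.
have des1 : t 1%N ^+ signed_des u s 1 =
    t 1%N ^+ (~~ (v u 1 < v u 2)%N && neg s 1)
    * t 1%N ^+ ((v u 1 < v u 2)%N && neg s 2).
  by rewrite /signed_des /=; case: ltnP; rewrite /= ?mulr1 ?mul1r.
rewrite [RHS]big_ltn // [in RHS]big_ltn // 2?[in RHS]big_nat_recr //=.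
rewrite term1 term2 term3 term4 (eq_big_nat _ _ termE) big_split /=.
rewrite big_ltn // big_ltn // -/(t _) -/(t _) des0 des1.
rewrite (eq_big_nat _ _ (F2 := fun j => P j * Q j.-1)); last first.
  by move=> j /andP[j2 _]; exact: desE.
(* The shift turns the [Q j.-1] for [j] from 2 to [n] into the [Q j] for [j] from 1 to [n.-1]. *)
rewrite big_split /= (big_add1 _ _ 1 n.+1 (fun=> true) (fun j => Q j.-1)) /=.
have -> : \prod_(2 <= i < n.+1) P i =
    P 2 * \prod_(3 <= i < m.+3) P i * P m.+3 * P n.
  by rewrite big_ltn // 2?big_nat_recr //= !mulrA.
have -> : \prod_(1 <= i < n) Q i =
    Q 1 * Q 2 * \prod_(3 <= i < m.+3) Q i * Q m.+3.
  by rewrite big_ltn // big_ltn // big_nat_recr //= !mulrA.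
(* Both sides now have the same factors; abstracting them leaves a commutative ring identity. *)
do 4!move: (t _ ^+ _) => ?.
move: (\prod_(_ <= _ < _) _) (\prod_(_ <= _ < _) _) => ? ?.
by ring.
Qed.

Lemma sum_even_signed_perm u :
  (\sum_(s : {ffun 'I_n -> bool} | ~~ odd (nb_neg s))
     \prod_(i in affine_Des (signed_perm (u, s))) ('X_i : {mpoly rat[n.+1]})) *+ 2
  = \prod_(1 <= i < n.+1) d_factor u i.
Proof.
rewrite big_add1 big_mkord; under [RHS]eq_bigr do rewrite d_factorE.
(* The sign flipped is that of the entry of absolute value 1, at position [u^-1 ord0]. *)
rewrite (@sum_even_signs n _ (fun i => d_term u i.+1) (u^-1 ord0)%g).
  by under eq_bigr do rewrite prod_affine_Des_signed_perm.
by rewrite !d_term_eq1 ?permKV.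
Qed.

End LargeRank.

Theorem proposition5p10 (n : nat) (hn : (4 <= n)%N) :
  affine_eulerianD n =
    2^-1 *: \sum_(u : 'S_n) \prod_(1 <= i < n.+1) d_factor u i.
Proof.
case: n hn => [|[|[|[|m]]]] // _.
under [in RHS]eq_bigr do rewrite -sum_even_signed_perm.
(* The doubling for each [u] cancels the coefficient 1/2; what remains is to reindex the sum over
   the group by pairs. *)
rewrite sumrMnl -scaler_nat scalerA mulVf // scale1r.
rewrite /affine_eulerianD weylD_signed_perm big_imset; last first.
  by move=> p q _ _; exact: signed_perm_injective.
rewrite [RHS]pair_big_dep /=.
by apply: eq_big => [[u s]|[u s] _] //; rewrite inE.
Qed.
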